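(* Let $p,q,s\in[1,\infty)$ and $\alpha\in\mathbb{R}$ be constants, let $m_0=\max(2,p,q,s)$, and let $\xi$ be a centered random process. Put $$\kappa(m)=K_R(m)\cdot|d_m(t+z\delta,t)|_{p,T;\ q,[-1,1];\ s,T,\nu},\qquad m>m_0,$$ and suppose that $\kappa(m)<\infty$ for all $m\in(m_0,L')$, where $m_0<L'\le\infty$. Then for every $n\ge1$ the random variable $\tau=\|S_n(\cdot)\|B^{o,p,q}_{\alpha,s}$ belongs to $G\kappa$ with $\|\tau\|G\kappa\le1$, and $$T_\tau(u)\le\exp\left(-\tilde\kappa^*(\ln u)\right),\qquad u>e.$$
   Context: $T=[0,1]$. $\xi=\xi(t)=\xi(t,\omega)$, $t\in T$, is a real-valued bi-measurable random process on a probability space $(\Omega,F,\mathbf{P})$, centered: $\mathbf{E}\xi(t)=0$ for $t\in T$. $\xi_1=\xi,\xi_2,\dots$ are independent identically distributed copies of $\xi$ and $S_n(t)=n^{-1/2}\sum_{j=1}^n\xi_j(t)$. Every function $f:T\to\mathbb{R}$ (in particular every trajectory) is extended to $\mathbb{R}$ by $0$ outside $T$. Put $S_h[f](t)=f(t+h)-f(t)$, $t\in T$, $h\in[-1,1]$, and $|f|_{p,T}=\left(\int_0^1|f(t)|^p\,dt\right)^{1/p}$. For $\delta\in[0,1]$ let $\Delta_q[f,\delta]_p=\left[\int_{-\delta}^{\delta}|S_h[f]|_{p,T}^q\,dh\right]^{1/q}$ and $$\|f\|B^{o,p,q}_{\alpha,s}=\left\{\int_0^1\left[\delta^{-\alpha}\Delta_q[f,\delta]_p\right]^s\frac{d\delta}{\delta}\right\}^{1/s};$$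 $B^{o,p,q}_{\alpha,s}$ is the space of measurable $f$ with this quantity finite. For a random variable $\eta$, $|\eta|_m=(\mathbf{E}|\eta|^m)^{1/m}$. Let $d_m(t,t')=|\xi(t)-\xi(t')|_m$ and $\nu(d\delta)=\delta^{\frac{s}{q}-\alpha s-1}\,d\delta$ on $T$. The mixed norm is taken from the inside out (first $t\in T$, then $z\in[-1,1]$, then $\delta\in T$): $$|d_m(t+z\delta,t)|_{p,T;\ q,[-1,1];\ s,T,\nu}=\left(\int_0^1\nu(d\delta)\left(\int_{-1}^1dz\left(\int_0^1 d_m(t+z\delta,t)^p\,dt\right)^{q/p}\right)^{s/q}\right)^{1/s}.$$ $K_R(m)$ is the Rosenthal constant $K_R(m)=\sup_{n\ge1}\sup_{\{\zeta_k\}}\left|n^{-1/2}\sum_{k=1}^n\zeta_k\right|_m/|\zeta_1|_m$, the inner supremum being over sequences of centered i.i.d. real random variables with $0<|\zeta_1|_m<\infty$. The Grand Lebesgue space $G\kappa$ consists of random variables $\eta$ with finite norm $\|\eta\|G\kappa=\sup_{m\in(m_0,L')}|\eta|_m/\kappa(m)$. Also $T_\eta(u)=\max(\mathbf{P}(\eta>u),\mathbf{P}(\eta<-u))$, $\tilde\kappa(m)=m\ln\kappa(m)$, and $\tilde\kappa^*(y)=\sup_m(m|y|-\tilde\kappa(m))$ over $m\in(m_0,L')$. *)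

(* Defs.v *)
From mathcomp Require Export all_boot all_order all_algebra finmap.
From mathcomp Require Export all_classical all_reals all_analysis measurable_realfun.

Set Implicit Arguments.
Unset Strict Implicit.
Unset Printing Implicit Defensive.

Import Order.TTheory GRing.Theory Num.Theory.
Import numFieldNormedType.Exports.

Local Open Scope classical_set_scope.
Local Open Scope ring_scope.

Definition T01 (R : realType) : set R := `[0, 1].

(* Extension by 0 outside [0, 1]: only the values of [f] on [0, 1] matter. *)
Definition ext0 (R : realType) (f : R -> R) (t : R) : R :=
  if t \in `[0, 1] then f t else 0.

Definition Lp_on (R : realType) (D : set R) (p : R) (f : R -> \bar R) : \bar R :=
  ((\int[lebesgue_measure]_(t in D) (`|f t| `^ p)) `^ p^-1)%E.

Definition shift_diff (R : realType) (f : R -> R) (h t : R) : R :=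
  ext0 f (t + h) - ext0 f t.

Definition Delta (R : realType) (p q : R) (f : R -> R) (delta : R) : \bar R :=
  Lp_on `[- delta, delta] q
    (fun h => Lp_on (@T01 R) p (fun t => (shift_diff f h t)%:E)).

Definition Besov_norm (R : realType) (p q s alpha : R) (f : R -> R) : \bar R :=
  ((\int[lebesgue_measure]_(delta in @T01 R)
      (((delta `^ (- alpha))%:E * Delta p q f delta) `^ s * (delta^-1)%:E))
   `^ s^-1)%E.

(* The mixed norm of the function [g t z delta], innermost norm in [t], with
   nu (d delta) = delta ^ (s / q - alpha s - 1) d delta. *)
Definition mixed_norm (R : realType) (p q s alpha : R) (g : R -> R -> R -> \bar R)
    : \bar R :=
  ((\int[lebesgue_measure]_(delta in @T01 R)
      ((delta `^ (s / q - alpha * s - 1))%:E *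
       Lp_on `[(-1)%R, 1%R] q (fun z => Lp_on (@T01 R) p (fun t => g t z delta)) `^ s))
   `^ s^-1)%E.

Section iid.
Context (d : measure_display) (Omega : measurableType d) (R : realType).
Variable P : probability Omega R.

(* [E] carries the sigma-algebra [S]. *)
Definition independent (E : Type) (S : set (set E)) (X : nat -> Omega -> E) : Prop :=
  forall (J : {fset nat}) (A : nat -> set E),
    (forall k, k \in J -> S (A k)) ->
    P (\bigcap_(k in [set` J]) X k @^-1` A k) =
    (\prod_(k <- J) P (X k @^-1` A k))%E.

Definition identically_distributed (E : Type) (S : set (set E))
    (X : nat -> Omega -> E) : Prop :=
  forall k (A : set E), S A -> P (X k @^-1` A) = P (X 0%N @^-1` A).

Definition iid (E : Type) (S : set (set E)) (X : nat -> Omega -> E) : Prop :=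
  independent S X /\ identically_distributed S X.

Definition centered (X : Omega -> R) : Prop :=
  P.-integrable setT (EFin \o X) /\ ('E_P[X] = 0)%E.

Definition normalized_sum (n : nat) (X : nat -> Omega -> R) (w : Omega) : R :=
  (Num.sqrt n%:R)^-1 * \sum_(k < n) X k w.

End iid.

(* The sigma-algebra on paths generated by the coordinates [f |-> f t] with
   [t] in [0, 1]. The law of a process is its law on this sigma-algebra. *)
Definition path_sigma (R : realType) : set (set (R -> R)) :=
  <<s [set A | exists t : R, exists B : set R,
         [/\ T01 t, measurable B & A = [set f | B (f t)]]] >>.

Definition bimeasurable (R : realType) (d : measure_display)
    (Omega : measurableType d) (xi : R -> Omega -> R) : Prop :=
  measurable_fun (@T01 R `*` [set: Omega]) (fun x : R * Omega => xi x.1 x.2).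

Definition Sn (R : realType) (d : measure_display) (Omega : measurableType d)
    (xi : nat -> R -> Omega -> R) (n : nat) (w : Omega) (t : R) : R :=
  normalized_sum n (fun k => xi k t) w.

Definition dist (R : realType) (d : measure_display) (Omega : measurableType d)
    (P : probability Omega R) (xi : R -> Omega -> R) (m t t' : R) : \bar R :=
  'N[P]_(m%:E)[(fun w => (ext0 (xi ^~ w) t - ext0 (xi ^~ w) t')%:E)]%E.

Definition Rosenthal_ratios (R : realType) (m : R) (n : nat) : set (\bar R) :=
  [set v | exists (d : measure_display) (Omega : measurableType d)
             (P : probability Omega R) (zeta : nat -> {RV P >-> R}),
     [/\ iid P (@measurable _ R) (fun k => zeta k : Omega -> R),
         forall k, centered P (zeta k),
         (0 < 'N[P]_(m%:E)[EFin \o zeta 0%N] < +oo)%E &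
         v = ('N[P]_(m%:E)[EFin \o normalized_sum n (fun k => zeta k)]
              / 'N[P]_(m%:E)[EFin \o zeta 0%N])%E]].

Definition K_R (R : realType) (m : R) : \bar R :=
  ereal_sup [set ereal_sup (Rosenthal_ratios m n) | n in [set n | (1 <= n)%N]].

Definition exponents (R : realType) (m0 : R) (L : \bar R) : set R :=
  [set m | m0 < m /\ (m%:E < L)%E].

Section GrandLebesgue.
Context (R : realType) (m0 : R) (L : \bar R) (kappa : R -> \bar R).
Context (d : measure_display) (Omega : measurableType d).
Variable P : probability Omega R.

(* In [\bar R], [0 / 0 = 0]: this value occurs only when [kappa] vanishes. *)
Definition GL_norm (Y : Omega -> \bar R) : \bar R :=
  ereal_sup [set ('N[P]_(m%:E)[Y] / kappa m)%E | m in exponents m0 L].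

Definition in_GL (Y : Omega -> \bar R) : Prop :=
  measurable_fun setT Y /\ (GL_norm Y < +oo)%E.

Definition tail (Y : Omega -> \bar R) (u : R) : \bar R :=
  maxe (P [set w | (u%:E < Y w)%E]) (P [set w | (Y w < (- u)%:E)%E]).

Definition kappa_tilde (m : R) : \bar R := (m%:E * lne (kappa m))%E.

Definition kappa_tilde_star (y : R) : \bar R :=
  ereal_sup [set ((m * `|y|)%:E - kappa_tilde m)%E | m in exponents m0 L].

End GrandLebesgue.

Definition kappa (R : realType) (d : measure_display) (Omega : measurableType d)
    (P : probability Omega R) (p q s alpha : R) (xi : R -> Omega -> R) (m : R)
    : \bar R :=
  (K_R m *
   mixed_norm p q s alpha (fun t z delta => dist P xi m (t + z * delta) t))%E.

(* Main.v *)
Require Import Defs.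
From HB Require Import structures.
From mathcomp Require Import ring lra.
Import Order.TTheory GRing.Theory Num.Theory.
Import numFieldNormedType.Exports.
Local Open Scope classical_set_scope.
Local Open Scope ring_scope.

Set Implicit Arguments.
Unset Strict Implicit.
Unset Printing Implicit Defensive.

(** Fix an exponent [m > m0]; the heart of the matter is that the [L^m] norm of
    [tau] is at most [kappa m].

    The substitution [h = z * delta] removes the dependence of the domain of
    integration on [delta] and turns the Besov norm of a path of [S_n] into the
    mixed norm of its increments [S_n(t + z delta) - S_n(t)]
    ([Besov_norm_mixed]).  Since [m] exceeds each of [p], [q] and [s],
    Minkowski's integral inequality moves the [L^m(P)] norm through the layers
    in [delta], [z] and [t], one after the other ([Lnorm_Lp_on_le],
    [Lnorm_mixed_norm_le]).  What remains inside is, for fixed [t], [z] and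
    [delta], the [L^m] norm of a normalized sum of independent identically
    distributed centered variables, namely the increments of the copies of the
    process; the very definition of [K_R m] as a supremum bounds it by
    [K_R m] times the [L^m] norm of one increment, that is by
    [K_R m * d_m(t + z delta, t)] ([Lnorm_normalized_sum_le]).  Mixed norms are
    monotone and homogeneous ([le_mixed_normZl]), which gives [kappa m].

    The supremum defining [K_R] runs over variables with norm in [(0, +oo)], so
    increments of norm [0] and [+oo] need separate arguments.  Norm [0] makes
    all the copies vanish almost surely.  For norm [+oo] it must be known that
    [0 < K_R m]: the centered indicators of the events where the copies are
    positive form a bounded nontrivial admissible sequence ([K_R_gt0]).

    Membership in the Grand Lebesgue space is then immediate, and the tail
    bound is Markov's inequality for each [m], optimized over [m]
    ([tail_le_expeR]).

    Minkowski's integral inequality for functions with values in the extended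
    reals ([minkowski_integral]) is proved without dividing by a possibly
    infinite quantity.  With [H = \int_D G] and [C] slightly larger than the
    right-hand side, apply Young's inequality to [G_x * b^(r-1)] for the bounded
    function [b = min(H, N) / C], integrate over everything and exchange the
    integrals: the result [E b^r <= 1/r + (1 - 1/r) E b^r] forces
    [E b^r <= 1], and monotone convergence in [N] concludes. *)

(** * Measurability and powers *)

(** Serves to permute or freeze the arguments of a jointly measurable function. *)
Lemma measurable_fun_comp2 dX dY dZ dU (X : measurableType dX) (Y : measurableType dY)
    (Z : measurableType dZ) (U : measurableType dU) (F : X -> Y -> U) (f : Z -> X) (g : Z -> Y) :
  measurable_fun setT (fun u : X * Y => F u.1 u.2) ->
  measurable_fun setT f -> measurable_fun setT g ->
  measurable_fun setT (fun z => F (f z) (g z)).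
Proof.
by move=> mF mf mg; exact: (measurableT_comp mF (measurable_fun_pair mf mg)).
Qed.

Section Powers.
Context {R : realType}.
Local Open Scope ereal_scope.

Lemma lee_poweR (r : R) (x y : \bar R) : (0 <= r)%R -> 0 <= x -> x <= y ->
  x `^ r <= y `^ r.
Proof.
move=> r0 x0 xy; apply: gt0_ler_poweR => //.
- by rewrite in_itv/= x0 leey.
- by rewrite in_itv/= (le_trans x0 xy) leey.
Qed.

Lemma poweRK (r : R) (x : \bar R) : r != 0%R -> 0 <= x -> (x `^ r) `^ r^-1 = x.
Proof. by move=> r0 x0; rewrite -poweRrM mulfV// poweRe1. Qed.

Lemma poweRVK (r : R) (x : \bar R) : r != 0%R -> 0 <= x -> (x `^ r^-1) `^ r = x.
Proof. by move=> r0 x0; rewrite -poweRrM mulVf// poweRe1. Qed.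

Lemma measurable_fun_poweR d (T : measurableType d) (D : set T) (f : T -> \bar R) (r : R) :
  measurable_fun D f -> measurable_fun D (fun x => f x `^ r).
Proof. by move=> mf; apply: (measurableT_comp (measurable_poweR _)). Qed.

(** Young's inequality [x * y <= x^r / r + (1 - 1/r) * y^(r/(r-1))] for
    [x = a / c] and [y = b^(r-1)].  The free scale [c] is later taken to be the
    [L^r] norm of [a], which makes the first summand integrate to [1 / r]. *)
Lemma young_scaled (r c b : R) (a : \bar R) : (1 < r)%R -> (0 < c)%R -> (0 <= b)%R ->
  0 <= a ->
  a * (b `^ (r - 1))%:E <= c%:E * ((c `^ (- r) / r)%:E * a `^ r + ((1 - r^-1) * b `^ r)%:E).
Proof.
move=> r1 c0 b0; have r0 : (0 < r)%R by exact: lt_trans r1.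
case: a => [a| _|//]; last first.
  rewrite poweRyr ?gt_eqF// gt0_muley ?lte_fin ?divr_gt0 ?powR_gt0//.
  by rewrite addye// gt0_muley ?lte_fin// leey.
rewrite lee_fin => a0; rewrite poweR_EFin -[X in _ <= _ * (X + _)]EFinM -EFinD -!EFinM lee_fin.
have r10 : (0 < r - 1)%R by rewrite subr_gt0.
have q0 : (0 < r / (r - 1))%R by rewrite divr_gt0.
have pq : (r^-1 + (r / (r - 1))^-1 = 1)%R.
  by rewrite invf_div mulrBl mul1r mulfV ?gt_eqF// addrC subrK.
have := conjugate_powR (divr_ge0 a0 (ltW c0)) (powR_ge0 b (r - 1)) r0 q0 pq.
rewrite -powRrM mulrCA mulfV ?gt_eqF// mulr1 => h.
have -> : (a * b `^ (r - 1) = c * (a / c * b `^ (r - 1)))%R.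
  by rewrite mulrA mulrCA mulfV ?gt_eqF// mulr1.
rewrite ler_pM2l//; apply: le_trans h _.
have -> : ((a / c) `^ r = a `^ r * c `^ (- r))%R.
  apply: (mulIf (lt0r_neq0 (powR_gt0 r c0))).
  rewrite -powRM ?divr_ge0 ?(ltW c0)// divfK ?gt_eqF//.
  by rewrite powRN mulfVK ?gt_eqF ?powR_gt0.
rewrite invf_div mulrBl mulfV ?gt_eqF//; lra.
Qed.

End Powers.

(** * Integration over a part of the space, with a parameter *)

Section Tonelli.
Context d1 d2 (X : measurableType d1) (Y : measurableType d2) (R : realType).
Local Open Scope ereal_scope.

Lemma measurable_integral_param (mu : {sigma_finite_measure set X -> \bar R}) (D : set X)
    (G : X -> Y -> \bar R) : measurable D ->
  measurable_fun setT (fun u : X * Y => G u.1 u.2) -> (forall x y, 0 <= G x y) ->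
  measurable_fun setT (fun y => \int[mu]_(x in D) G x y).
Proof.
move=> mD mG G0.
pose f := (fun u : X * Y => G u.1 u.2) \_ (D `*` setT).
have mf : measurable_fun setT f.
  apply/(measurable_restrictT _ _).1; first exact: measurableX.
  exact: measurable_funTS.
have f0 u : 0 <= f u by apply: erestrict_ge0.
have := measurable_fun_fubini_tonelli_G (m1 := mu) f mf f0.
congr measurable_fun; apply/funext => y.
rewrite /fubini_G [in RHS]integral_mkcond; apply: eq_integral => x _.
rewrite /f /patch/=.
by congr (if _ then _ else _); apply/idP/idP; rewrite !inE => // -[].
Qed.

Lemma tonelli_on (mu : {sigma_finite_measure set X -> \bar R})
    (nu : {sigma_finite_measure set Y -> \bar R}) (D : set X)
    (G : X -> Y -> \bar R) : measurable D ->
  measurable_fun setT (fun u : X * Y => G u.1 u.2) -> (forall x y, 0 <= G x y) ->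
  \int[nu]_y \int[mu]_(x in D) G x y = \int[mu]_(x in D) \int[nu]_y G x y.
Proof.
move=> mD mG G0.
pose f := (fun u : X * Y => G u.1 u.2) \_ (D `*` setT).
have mf : measurable_fun setT f.
  apply/(measurable_restrictT _ _).1; first exact: measurableX.
  exact: measurable_funTS.
have f0 u : 0 <= f u by apply: erestrict_ge0.
have fE x y : f (x, y) = if x \in D then G x y else 0.
  rewrite /f /patch/=.
  by congr (if _ then _ else _); apply/idP/idP; rewrite !inE => // -[].
have <- : \int[nu]_y \int[mu]_x f (x, y) = \int[nu]_y \int[mu]_(x in D) G x y.
  by apply: eq_integral => y _; rewrite [in RHS]integral_mkcond; apply: eq_integral.
rewrite -(fubini_tonelli (m1 := mu) (m2 := nu) f mf f0).
rewrite [in RHS]integral_mkcond; apply: eq_integral => x _.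
rewrite /patch; case: ifPn => xD.
  by apply: eq_integral => y _; rewrite fE xD.
by apply: integral0_eq => y _; rewrite fE (negbTE xD).
Qed.

End Tonelli.

(** * Minkowski's integral inequality *)

Section Truncation.
Context d (Omega : measurableType d) (R : realType).
Variable P : {measure set Omega -> \bar R}.
Local Open Scope ereal_scope.

(** Bounded truncations suffice to bound an integral, by monotone convergence. *)
Lemma le_integral_trunc (f : Omega -> \bar R) (M : \bar R) :
  measurable_fun setT f -> (forall w, 0 <= f w) ->
  (forall n : nat, \int[P]_w mine (f w) n%:R%:E <= M) ->
  \int[P]_w f w <= M.
Proof.
move=> mf f0 H.
have mg n : measurable_fun setT (fun w => mine (f w) n%:R%:E).
  by apply: measurable_mine => //; exact: measurable_cst.
have g0 n w : 0 <= mine (f w) n%:R%:E by rewrite le_min f0 lee_fin ler0n.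
have ndg w : {homo (fun n : nat => mine (f w) n%:R%:E) : m n / (m <= n)%N >-> m <= n}.
  by move=> m n mn; rewrite le_min ge_min lexx /= ge_min lee_fin ler_nat mn orbT.
have lim_g w : limn (fun n : nat => mine (f w) n%:R%:E) = f w.
  apply/cvg_lim => //; have := f0 w; case: (f w) => [x| |//] x0.
    apply: cvg_near_cst; near=> n.
    by rewrite /mine lte_fin; case: ltP => // h; congr EFin; apply/eqP;
      rewrite eq_le h /=; near: n; exact: nbhs_infty_ger.
  under eq_fun do rewrite minye.
  by apply/cvgenyP/cvg_id.
under eq_integral do rewrite -lim_g.
rewrite monotone_convergence//.
apply: lime_le; last exact: nearW.
apply: ereal_nondecreasing_is_cvgn => m n mn.
by apply: ge0_le_integral => // w _; exact: ndg.
Unshelve. all: by end_near. Qed.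

End Truncation.

Section Minkowski.
Context d1 d2 (X : measurableType d1) (Omega : measurableType d2) (R : realType).
Variables (mu : {sigma_finite_measure set X -> \bar R}) (P : probability Omega R).
Local Open Scope ereal_scope.

(** Integrated form of [young_scaled] with [c] the [L^r] norm of [g].  It replaces
    Hoelder's inequality: the right-hand side is linear in [c], so it can be
    integrated over a further variable on which [g] depends. *)
Lemma integral_mul_powR_le (r : R) (g : Omega -> \bar R) (b : Omega -> R) :
  (1 < r)%R -> measurable_fun setT g -> (forall w, 0 <= g w) ->
  measurable_fun setT b -> (forall w, 0 <= b w)%R ->
  \int[P]_w (g w * (b w `^ (r - 1))%:E) <=
  (\int[P]_w g w `^ r) `^ r^-1 *
    (r^-1%:E + (1 - r^-1)%:E * \int[P]_w (b w `^ r)%:E).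
Proof.
move=> r1 mg g0 mb b0; have r0 : (0 < r)%R by exact: lt_trans r1.
have r'0 : (0 <= 1 - r^-1)%R by rewrite subr_ge0 invf_le1// ltW.
have mbr s : measurable_fun setT (fun w => (b w `^ s)%:E).
  by apply/measurable_EFinP; exact: (measurableT_comp (measurable_powR s)).
have I0 : 0 <= \int[P]_w (b w `^ r)%:E.
  by apply: integral_ge0 => w _; rewrite lee_fin powR_ge0.
have A0 : 0 < r^-1%:E + (1 - r^-1)%:E * \int[P]_w (b w `^ r)%:E.
  by rewrite (@lt_le_trans _ _ r^-1%:E) ?lte_fin ?invr_gt0// leeDl// mule_ge0.
have mgr := measurable_fun_poweR r mg.
have J0 : 0 <= \int[P]_w g w `^ r by apply: integral_ge0 => w _; exact: poweR_ge0.
(* An infinite norm is harmless, since the factor in parentheses is positive. *)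
have := poweR_ge0 (\int[P]_w g w `^ r) r^-1.
case E : (_ `^ r^-1) => [c| |//] c0; last by rewrite gt0_mulye// leey.
have Ec : \int[P]_w g w `^ r = (c `^ r)%:E.
  by rewrite -poweR_EFin -E poweRVK// gt_eqF.
move: c0; rewrite lee_fin le_eqVlt => /predU1P[c0|c0].
  rewrite -c0 mul0e.
  have : \int[P]_w `|g w `^ r| = 0.
    by under eq_integral do rewrite gee0_abs ?poweR_ge0//; rewrite Ec -c0 powR0// gt_eqF.
  move/(ae_eq_integral_abs P measurableT mgr) => h.
  rewrite (@ge0_ae_eq_integral _ _ _ P setT _ (cst 0)) ?integral0//.
  - exact: emeasurable_funM.
  - by move=> w _; rewrite mule_ge0// lee_fin powR_ge0.
  - apply: filterS h => w /(_ I) /= /(poweR_eq0_eq0 (g0 w)) -> _.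
    by rewrite mul0e.
apply: (@le_trans _ _ (\int[P]_w (c%:E * ((c `^ (- r) / r)%:E * g w `^ r
    + ((1 - r^-1) * b w `^ r)%:E)))).
  apply: ge0_le_integral => //.
  - by move=> w _; rewrite mule_ge0// lee_fin powR_ge0.
  - exact: emeasurable_funM.
  - apply: measurable_funeM; apply: emeasurable_funD; first exact: measurable_funeM.
    by under eq_fun do rewrite EFinM; exact: measurable_funeM.
  - by move=> w _; exact: young_scaled.
have cr0 : (0 <= c `^ (- r) / r)%R by rewrite divr_ge0 ?powR_ge0// ltW.
have h1 w : setT w -> 0 <= (c `^ (- r) / r)%:E * g w `^ r.
  by move=> _; rewrite mule_ge0 ?poweR_ge0.
have h2 w : setT w -> 0 <= ((1 - r^-1) * b w `^ r)%:E.
  by move=> _; rewrite lee_fin mulr_ge0// powR_ge0.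
have m1 : measurable_fun setT (fun w => (c `^ (- r) / r)%:E * g w `^ r).
  exact: measurable_funeM.
have m2 : measurable_fun setT (fun w => ((1 - r^-1) * b w `^ r)%:E).
  by under eq_fun do rewrite EFinM; exact: measurable_funeM.
rewrite ge0_integralZl//; last 3 first.
- exact: emeasurable_funD.
- by move=> w _; apply: adde_ge0; [exact: h1|exact: h2].
- by rewrite lee_fin ltW.
rewrite ge0_integralD// ge0_integralZl//; last first.
- by move=> w _; exact: poweR_ge0.
under [X in _ + X]eq_integral do rewrite EFinM.
rewrite ge0_integralZl//; last first.
- by move=> w _; rewrite lee_fin powR_ge0.
rewrite Ec -EFinM; apply: lee_wpmul2l; first by rewrite lee_fin ltW.
apply: leeD => //.
by rewrite lee_fin mulrAC -powRD ?subrr ?addNr ?powRr0 ?mul1r// (gt_eqF c0) implybT.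
Qed.

(** The truncation [b] of [\int_D G], divided by [C' > C], has a finite [r]-th moment
    because [P] is finite, so the self-improving bound
    [I <= 1/r + (1 - 1/r) * I] on that moment [I] can be solved for [I]. *)
Lemma minkowski_integral (r : R) (D : set X) (G : X -> Omega -> \bar R) :
  (1 < r)%R -> measurable D ->
  measurable_fun setT (fun u : X * Omega => G u.1 u.2) -> (forall x w, 0 <= G x w) ->
  (\int[P]_w (\int[mu]_(x in D) G x w) `^ r) `^ r^-1 <=
  \int[mu]_(x in D) (\int[P]_w G x w `^ r) `^ r^-1.
Proof.
move=> r1 mD mG G0; have r0 : (0 < r)%R by exact: lt_trans r1.
have r'0 : (0 <= 1 - r^-1)%R by rewrite subr_ge0 invf_le1// ltW.
set C := (leRHS); set H := fun w => \int[mu]_(x in D) G x w.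
have H0 w : 0 <= H w by exact: integral_ge0.
have mH : measurable_fun setT H by exact: measurable_integral_param.
have mGx x : measurable_fun setT (G x).
  exact: (measurable_fun_comp2 mG).
have mc : measurable_fun setT (fun x => (\int[P]_w G x w `^ r) `^ r^-1).
  apply: measurable_fun_poweR.
  apply: (@measurable_integral_param _ _ Omega X R P setT (fun w x => G x w `^ r)) => //.
    apply: measurable_fun_poweR.
    exact: (measurable_fun_comp2 mG measurable_snd measurable_fst).
  by move=> w x; exact: poweR_ge0.
have C0 : 0 <= C by apply: integral_ge0 => x _; exact: poweR_ge0.
move: C0; case E : C => [c| |//] C0; last by rewrite leey.
move: C0; rewrite lee_fin => c0; apply/lee_addgt0Pr => e e0.
rewrite -EFinD; set C' := (c + e)%R; have C'0 : (0 < C')%R by rewrite ltr_wpDl.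
suff hr : \int[P]_w H w `^ r <= (C' `^ r)%:E.
  rewrite -(@poweRK _ r C'%:E) ?gt_eqF ?lee_fin ?(ltW C'0)//.
  apply: lee_poweR; rewrite ?invr_ge0 ?(ltW r0)//.
  by apply: integral_ge0 => w _; exact: poweR_ge0.
apply: le_integral_trunc; first exact: measurable_fun_poweR.
  by move=> w; exact: poweR_ge0.
(* [N = n^(1/r)], so that truncating [H] at [N] truncates [H^r] at [n]. *)
move=> n; set N : R := (n%:R `^ r^-1)%R.
have N0 : (0 <= N)%R by exact: powR_ge0.
pose b w := (fine (mine (H w) N%:E) / C')%R.
have hN w : mine (H w) N%:E = (C' * b w)%:E.
  rewrite /b mulrCA mulfV ?gt_eqF// mulr1 fineK// ge0_fin_numE ?le_min ?H0//.
  by rewrite gt_min ltry orbT.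
have b0 w : (0 <= b w)%R.
  by rewrite divr_ge0 ?(ltW C'0)// fine_ge0// le_min H0.
have bN w : (b w <= N / C')%R.
  rewrite ler_pM2r ?invr_gt0// -lee_fin fineK ?ge_min ?lexx ?orbT//.
  by rewrite ge0_fin_numE ?le_min ?H0// gt_min ltry orbT.
have mb : measurable_fun setT b.
  apply: measurable_funM => //; apply: (measurableT_comp (@fine_measurable _ setT measurableT)).
  by apply: measurable_mine => //; exact: measurable_cst.
have mbr s : measurable_fun setT (fun w => (b w `^ s)%:E).
  by apply/measurable_EFinP; exact: (measurableT_comp (measurable_powR s)).
set I := \int[P]_w (b w `^ r)%:E.
have I0 : 0 <= I by apply: integral_ge0 => w _; rewrite lee_fin powR_ge0.
have Ioo : I < +oo.
  apply: (@le_lt_trans _ _ (\int[P]_w (cst ((N / C') `^ r)%:E) w)).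
    apply: ge0_le_integral => //.
    - by move=> w _; rewrite lee_fin powR_ge0.
    - move=> w _; rewrite lee_fin ge0_ler_powR ?nnegrE ?(ltW r0)//.
      by rewrite divr_ge0 ?(ltW C'0).
  by rewrite integral_cst// [X in _ * X]probability_setT mule1 ltry.
set A := r^-1%:E + (1 - r^-1)%:E * I.
(* [C' b^r <= H b^(r-1)], because [C' b = min(H, N) <= H]; then Tonelli and Young. *)
have IA : C'%:E * I <= c%:E * A.
  apply: (@le_trans _ _ (\int[P]_w (H w * (b w `^ (r - 1))%:E))).
    rewrite -ge0_integralZl//; last 2 first.
    - by move=> w _; rewrite lee_fin powR_ge0.
    - by rewrite lee_fin ltW.
    apply: ge0_le_integral => //.
    - by move=> w _; rewrite mule_ge0 ?lee_fin ?powR_ge0 ?(ltW C'0).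
    - exact: measurable_funeM.
    - exact: emeasurable_funM.
    move=> w _; have : (C' * b w)%:E <= H w by rewrite -hN ge_min lexx.
    move: (b0 w); rewrite le_eqVlt => /predU1P[<- _|bw0 h].
      by rewrite powR0 ?gt_eqF// mule0 mule_ge0// lee_fin powR_ge0.
    have -> : (b w `^ r = b w * b w `^ (r - 1))%R.
      by rewrite -[X in (X * _)%R]powRr1 ?ltW// -powRD ?(gt_eqF bw0) ?implybT// addrC subrK.
    by rewrite -EFinM mulrA EFinM lee_wpmul2r// lee_fin powR_ge0.
  have -> : \int[P]_w (H w * (b w `^ (r - 1))%:E) =
      \int[P]_w \int[mu]_(x in D) (G x w * (b w `^ (r - 1))%:E).
    apply: eq_integral => w _; rewrite ge0_integralZr//.
    - exact: measurable_funTS (measurable_fun_comp2 mG _ _).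
    - by rewrite lee_fin powR_ge0.
  rewrite (@tonelli_on _ _ X Omega R mu P D
    (fun x w => G x w * (b w `^ (r - 1))%:E))//; last 2 first.
  - by apply: emeasurable_funM => //; exact: (measurableT_comp (mbr _) measurable_snd).
  - by move=> x w; rewrite mule_ge0// lee_fin powR_ge0.
  rewrite -E /C -ge0_integralZr//; last 3 first.
  - exact: measurable_funTS.
  - by move=> x _; exact: poweR_ge0.
  - by rewrite adde_ge0 ?mule_ge0// lee_fin invr_ge0 ltW.
  apply: ge0_le_integral => //.
  - move=> x _; apply: integral_ge0 => w _.
    by rewrite mule_ge0// lee_fin powR_ge0.
  - apply: measurable_funTS.
    apply: (@measurable_integral_param _ _ Omega X R P setT
      (fun w x => G x w * (b w `^ (r - 1))%:E)) => //.
      apply: emeasurable_funM.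
        exact: (measurable_fun_comp2 mG measurable_snd measurable_fst).
      exact: (measurableT_comp (mbr _) measurable_fst).
    by move=> w x; rewrite mule_ge0// lee_fin powR_ge0.
  - apply: emeasurable_funM; last exact: measurable_cst.
    exact: measurable_funTS.
  - by move=> x _; exact: integral_mul_powR_le.
have I1 : I <= 1.
  rewrite /A in IA; move: IA I0; case: (I) Ioo => [i| |]// _.
  move=> + i0; rewrite -EFinM -EFinD -!EFinM !lee_fin => h; move: i0; rewrite lee_fin => i0.
  have : (C' * i <= C' * (r^-1 + (1 - r^-1) * i))%R.
    apply: (le_trans h); rewrite ler_wpM2r ?lerDl ?(ltW e0)//.
    by rewrite addr_ge0 ?mulr_ge0// invr_ge0 ltW.
  rewrite ler_pM2l// => hi.
  have v0 : (0 < r^-1)%R by rewrite invr_gt0.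
  by rewrite -(ler_pM2l v0); lra.
apply: (@le_trans _ _ (\int[P]_w ((C' `^ r)%:E * (b w `^ r)%:E))).
  apply: ge0_le_integral => //.
  - by move=> w _; rewrite le_min poweR_ge0 lee_fin ler0n.
  - by apply: measurable_mine; [exact: measurable_fun_poweR|exact: measurable_cst].
  - exact: measurable_funeM.
  move=> w _; rewrite -EFinM -powRM ?(ltW C'0)// -poweR_EFin -hN.
  have [HN|HN] := leP (H w) N%:E.
    by rewrite /= ge_min lexx.
  by rewrite /= /N -powRrM mulVf ?gt_eqF// powRr1// ge_min lexx orbT.
rewrite ge0_integralZl//; last 2 first.
- by move=> w _; rewrite lee_fin powR_ge0.
- by rewrite lee_fin powR_ge0.
by rewrite -[leRHS]mule1 lee_wpmul2l ?lee_fin ?powR_ge0.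
Qed.

End Minkowski.

(** * Dilations of Lebesgue measure *)

Section Scaling.
Context {R : realType}.
Local Open Scope ereal_scope.
Local Notation leb := (@lebesgue_measure R).

(** Both sides are measures in [A] and agree on half-open intervals. *)
Lemma lebesgue_measure_scale (k : R) (A : set R) : (0 < k)%R -> measurable A ->
  leb A = k%:E * leb ((fun z => z * k)%R @^-1` A).
Proof.
move=> k0 mA.
pose phi : measurableTypeR R -> measurableTypeR R := fun z => (z * k)%R.
have mphi : measurable_fun setT phi by exact: measurable_funM.
pose kn := NngNum (ltW k0).
rewrite (@lebesgue_measure_unique R (mscale kn (pushforward leb phi)))//.
move=> _ [[a b]] _ <-; rewrite /= /mscale/= /pushforward.
have -> : (fun z : R => z * k)%R @^-1` `]a, b] = `](a / k)%R, (b / k)%R]%classic.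
  by apply/seteqP; split => z /=; rewrite !in_itv/= ltr_pdivrMr// ler_pdivlMr.
rewrite !lebesgue_measure_itv/= !lte_fin ltr_pM2r ?invr_gt0//.
case: ifPn => ab; last by rewrite mule0.
by rewrite -!EFinB -EFinM -mulrBl mulrCA mulfV ?gt_eqF// mulr1.
Qed.

Lemma integral_scale (k : R) (f : R -> \bar R) : (0 < k)%R ->
  measurable_fun setT f -> (forall x, 0 <= f x) ->
  \int[leb]_(h in `[(- k)%R, k]) f h = k%:E * \int[leb]_(z in `[(-1)%R, 1%R]) f (z * k)%R.
Proof.
move=> k0 mf f0.
pose phi : measurableTypeR R -> measurableTypeR R := fun z => (z * k)%R.
have mphi : measurable_fun setT phi by exact: measurable_funM.
pose kn := NngNum (ltW k0).
have -> : `[(-1)%R, 1%R]%classic = phi @^-1` `[(- k)%R, k]%classic.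
  have e1 z : (- k <= z * k)%R = (-1 <= z)%R by rewrite -[(- k)%R]mulN1r ler_pM2r.
  have e2 z : (z * k <= k)%R = (z <= 1)%R by rewrite -[leRHS]mul1r ler_pM2r.
  by apply/seteqP; split => z /=; rewrite !in_itv/= e1 e2.
rewrite -(@ge0_integral_pushforward _ _ _ _ R phi mphi leb _ f) //; last first.
  exact: measurable_funTS.
rewrite -(@ge0_integral_mscale _ _ R (pushforward leb phi) _ _ kn)//.
  apply: eq_measure_integral => A mA _.
  exact: lebesgue_measure_scale.
exact: measurable_funTS.
Qed.

End Scaling.

(** * Single-layer norms *)

Section Norms.
Context {R : realType}.
Local Open Scope ereal_scope.
Implicit Types (D : set R) (f g : R -> \bar R) (p k : R).

Lemma LnormEpow d (T : measurableType d) (mu : {measure set T -> \bar R}) p (f : T -> \bar R) :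
  'N[mu]_(p%:E)[f] = (\int[mu]_x `|f x| `^ p) `^ p^-1.
Proof. by rewrite unlock. Qed.

Lemma measurable_abs_poweR d (T : measurableType d) (D : set T) (f : T -> \bar R) p :
  measurable_fun D f -> measurable_fun D (fun x => `|f x| `^ p).
Proof. by move=> mf; apply: measurable_fun_poweR; exact: measurableT_comp. Qed.

Lemma Lp_on_ge0 D p f : 0 <= Lp_on D p f.
Proof. exact: poweR_ge0. Qed.

Lemma Lp_on0 D p : (0 < p)%R -> Lp_on D p (fun=> 0) = 0.
Proof.
move=> p0; rewrite /Lp_on integral0_eq ?poweR0r ?invr_neq0 ?gt_eqF//.
by move=> x _; rewrite abse0 poweR0r ?gt_eqF.
Qed.

Lemma le_Lp_on D p f g : (0 <= p)%R -> measurable D ->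
  measurable_fun D f -> measurable_fun D g ->
  (forall x, D x -> 0 <= f x) -> (forall x, D x -> f x <= g x) ->
  Lp_on D p f <= Lp_on D p g.
Proof.
move=> p0 mD mf mg f0 fg.
apply: lee_poweR; rewrite ?invr_ge0//; first by apply: integral_ge0 => *; exact: poweR_ge0.
apply: ge0_le_integral => //.
- by move=> *; exact: poweR_ge0.
- exact: measurable_abs_poweR.
- exact: measurable_abs_poweR.
- move=> x Dx; apply: lee_poweR => //.
  by rewrite !gee0_abs ?fg ?f0// (le_trans (f0 _ Dx))// fg.
Qed.

(** Infinite factors are included because [k] will be the Rosenthal constant. *)
Lemma Lp_onZl D p (k : \bar R) f : (0 < p)%R -> measurable D ->
  measurable_fun D f -> 0 <= k ->
  Lp_on D p (fun x => k * f x) = k * Lp_on D p f.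
Proof.
move=> p0 mD mf k0; rewrite /Lp_on.
under eq_integral do rewrite abseM (gee0_abs k0) poweRM//.
rewrite ge0_integralZl ?poweR_ge0//; last 2 first.
- exact: measurable_abs_poweR.
- by move=> *; exact: poweR_ge0.
rewrite poweRM ?poweR_ge0 ?poweRK ?gt_eqF//.
by apply: integral_ge0 => *; exact: poweR_ge0.
Qed.

Lemma measurable_Lp_on_param d (Y : measurableType d) D p (F : R -> Y -> \bar R) :
  measurable D -> measurable_fun setT (fun u : R * Y => F u.1 u.2) ->
  measurable_fun setT (fun y => Lp_on D p (F ^~ y)).
Proof.
move=> mD mF; apply: measurable_fun_poweR.
apply: (@measurable_integral_param _ _ (measurableTypeR R) Y R lebesgue_measure D
  (fun x y => `|F x y| `^ p)) => //; first exact: measurable_abs_poweR.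
by move=> *; exact: poweR_ge0.
Qed.

Lemma measurable_Lnorm_param dY (Y : measurableType dY) d (Omega : measurableType d)
    (P : probability Omega R) p (F : Y -> Omega -> \bar R) :
  measurable_fun setT (fun u : Y * Omega => F u.1 u.2) ->
  measurable_fun setT (fun y => 'N[P]_(p%:E)[F y]).
Proof.
move=> mF; under eq_fun do rewrite LnormEpow; apply: measurable_fun_poweR.
apply: (@measurable_integral_param _ _ Omega Y R P setT
  (fun w y => `|F y w| `^ p)) => //; last by move=> *; exact: poweR_ge0.
by apply: measurable_abs_poweR; exact: (measurable_fun_comp2 mF measurable_snd measurable_fst).
Qed.

(** Minkowski's integral inequality with exponent [r = m / p > 1] for the function
    [|F|^p], then the [p]-th root of both sides. *)
Lemma Lnorm_Lp_on_le d (Omega : measurableType d) (P : probability Omega R)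
    (p m : R) D (F : R -> Omega -> \bar R) :
  (0 < p)%R -> (p < m)%R -> measurable D ->
  measurable_fun setT (fun u : R * Omega => F u.1 u.2) ->
  'N[P]_(m%:E)[(fun w => Lp_on D p (F ^~ w))] <=
  Lp_on D p (fun t => 'N[P]_(m%:E)[F t]).
Proof.
move=> p0 pm mD mF; have m0 : (0 < m)%R by exact: lt_trans pm.
have r1 : (1 < m / p)%R by rewrite ltr_pdivlMr// mul1r.
have mG : measurable_fun setT (fun u : R * Omega => `|F u.1 u.2| `^ p).
  exact: measurable_abs_poweR.
have := @minkowski_integral _ _ (measurableTypeR R) Omega R lebesgue_measure P (m / p) D
  (fun t w => `|F t w| `^ p) r1 mD mG (fun _ _ => poweR_ge0 _ _).
move=> h.
have : 0 <= (\int[P]_w (\int[lebesgue_measure]_(x in D) `|F x w| `^ p) `^ (m / p)) `^ (m / p)^-1.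
  exact: poweR_ge0.
move=> /(fun l0 => lee_poweR (r := p^-1) _ l0 h); rewrite invr_ge0 (ltW p0) => /(_ isT) {}h.
rewrite LnormEpow.
have -> : \int[P]_x `|Lp_on D p (F ^~ x)| `^ m =
    \int[P]_w (\int[lebesgue_measure]_(x in D) `|F x w| `^ p) `^ (m / p).
  apply: eq_integral => w _.
  by rewrite gee0_abs ?Lp_on_ge0// /Lp_on -poweRrM mulrC.
have -> : Lp_on D p (fun t => 'N[P]_(m%:E)[F t]) =
   (\int[lebesgue_measure]_(x in D) (\int[P]_w (`|F x w| `^ p) `^ (m / p)) `^ (m / p)^-1) `^ p^-1.
  congr (_ `^ _); apply: eq_integral => t _.
  rewrite gee0_abs ?Lnorm_ge0// LnormEpow -poweRrM invf_div (mulrC m^-1%R).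
  congr (_ `^ _); apply: eq_integral => w _.
  by rewrite -poweRrM mulrC divfK ?gt_eqF.
by move: h; rewrite -poweRrM invf_div mulrAC mulfV ?gt_eqF// mul1r.
Qed.

End Norms.

(** * Mixed norms *)

Section Mixed.
Context {R : realType}.
Local Open Scope ereal_scope.
Implicit Types (p q s alpha m : R).

Lemma LnormZl_ge0 d (T : measurableType d) (mu : {measure set T -> \bar R}) p (k : \bar R)
    (f : T -> \bar R) : (0 < p)%R -> 0 <= k -> measurable_fun setT f ->
  'N[mu]_(p%:E)[(fun x => k * f x)] = k * 'N[mu]_(p%:E)[f].
Proof.
move=> p0 k0 mf; rewrite !LnormEpow.
under eq_integral do rewrite abseM (gee0_abs k0) poweRM//.
rewrite ge0_integralZl ?poweR_ge0//; last 2 first.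
- exact: measurable_abs_poweR.
- by move=> *; exact: poweR_ge0.
rewrite poweRM ?poweR_ge0 ?poweRK ?gt_eqF//.
by apply: integral_ge0 => *; exact: poweR_ge0.
Qed.

Lemma le_Lp_onZl (D : set R) p (k : \bar R) (f g : R -> \bar R) : (0 < p)%R -> measurable D ->
  measurable_fun D f -> measurable_fun D g -> 0 <= k ->
  (forall x, 0 <= f x) -> (forall x, f x <= k * g x) ->
  Lp_on D p f <= k * Lp_on D p g.
Proof.
move=> p0 mD mf mg k0 f0 fg; rewrite -Lp_onZl//.
by apply: le_Lp_on => //; [exact: ltW|exact: measurable_funeM].
Qed.

Lemma measurable_T01 : measurable (@T01 R).
Proof. exact: measurable_itv. Qed.

(** The layers of [mixed_norm] in [t] and [z], separated from the weighted layer in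
    [delta]. *)
Definition inner_norm p q (g : R -> R -> R -> \bar R) (delta : R) : \bar R :=
  Lp_on `[(-1)%R, 1%R] q (fun z => Lp_on (@T01 R) p (fun t => g t z delta)).

(** Absorbing the weight into the integrand, as its [s]-th root, makes the outermost
    layer an ordinary [L^s] norm, to which the lemmas on single layers apply. *)
Lemma mixed_normE p q s alpha g : (0 < s)%R ->
  mixed_norm p q s alpha g =
  Lp_on (@T01 R) s (fun delta =>
    (delta `^ ((s / q - alpha * s - 1) / s))%:E * inner_norm p q g delta).
Proof.
move=> s0; congr (_ `^ _); apply: eq_integral => delta _.
rewrite abseM poweRM// (gee0_abs (Lp_on_ge0 _ _ _)) gee0_abs ?lee_fin ?powR_ge0//.
by rewrite poweR_EFin -powRrM divfK ?gt_eqF.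
Qed.

Section Param.
Context dY (Y : measurableType dY).
Variables (F : R -> R -> R -> Y -> \bar R).
Hypothesis mF : measurable_fun setT
  (fun u : R * R * R * Y => F u.1.1.1 u.1.1.2 u.1.2 u.2).

Lemma measurable_fun_comp4 dZ (Z : measurableType dZ) (a b c : Z -> R) (e : Z -> Y) :
  measurable_fun setT a -> measurable_fun setT b -> measurable_fun setT c ->
  measurable_fun setT e -> measurable_fun setT (fun z => F (a z) (b z) (c z) (e z)).
Proof.
move=> ma mb mc me.
exact: (measurableT_comp mF (measurable_fun_pair (measurable_fun_pair
  (measurable_fun_pair ma mb) mc) me)).
Qed.

Lemma measurable_Lp_on_t p : measurable_fun setT
  (fun v : R * R * Y => Lp_on (@T01 R) p (fun t => F t v.1.1 v.1.2 v.2)).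
Proof.
apply: (@measurable_Lp_on_param _ _ (R * R * Y)%type _ p (fun t v => F t v.1.1 v.1.2 v.2)).
  exact: measurable_T01.
apply: (@measurable_fun_comp4 _ (R * (R * R * Y))%type) => //.
- by apply: measurableT_comp => //; apply: measurableT_comp.
- by apply: measurableT_comp => //; apply: measurableT_comp.
- by apply: measurableT_comp.
Qed.

Lemma measurable_inner_norm p q : measurable_fun setT
  (fun v : R * Y => inner_norm p q (fun t z delta => F t z delta v.2) v.1).
Proof.
apply: (@measurable_Lp_on_param _ _ (R * Y)%type _ q
  (fun z v => Lp_on (@T01 R) p (fun t => F t z v.1 v.2))); first exact: measurable_itv.
have h : measurable_fun setT (fun u : R * (R * Y) => ((u.1, u.2.1), u.2.2)).
  apply: measurable_fun_pair; last by apply: measurableT_comp.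
  by apply: measurable_fun_pair => //; apply: measurableT_comp.
exact: (measurableT_comp (measurable_Lp_on_t p) h).
Qed.

Lemma measurable_weight (e : R) : measurable_fun setT (fun delta : R => (delta `^ e)%:E).
Proof. by apply/measurable_EFinP; exact: measurable_powR. Qed.

Lemma measurable_mixed_norm p q s alpha : (0 < s)%R ->
  measurable_fun setT (fun y => mixed_norm p q s alpha (fun t z delta => F t z delta y)).
Proof.
move=> s0; under eq_fun do rewrite mixed_normE//.
apply: (@measurable_Lp_on_param _ _ Y _ s (fun delta y =>
  (delta `^ ((s / q - alpha * s - 1) / s))%:E * inner_norm p q (fun t z delta => F t z delta y) delta)).
  exact: measurable_T01.
apply: emeasurable_funM; last exact: measurable_inner_norm.
exact: (measurableT_comp (measurable_weight _) measurable_fst).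
Qed.

Lemma measurable_section_t z delta y : measurable_fun setT (fun t => F t z delta y).
Proof. exact: (@measurable_fun_comp4 _ _ id (cst z) (cst delta) (cst y)). Qed.

Lemma measurable_section_z p delta y :
  measurable_fun setT (fun z => Lp_on (@T01 R) p (fun t => F t z delta y)).
Proof.
have h : measurable_fun setT (fun z : R => ((z, delta), y)).
  by apply: measurable_fun_pair => //; apply: measurable_fun_pair.
exact: (measurableT_comp (measurable_Lp_on_t p) h).
Qed.

Lemma measurable_section_delta p q y :
  measurable_fun setT (inner_norm p q (fun t z delta => F t z delta y)).
Proof.
have h : measurable_fun setT (fun delta : R => (delta, y)) by exact: measurable_fun_pair.
exact: (measurableT_comp (measurable_inner_norm p q) h).
Qed.

End Param.

(** Monotonicity and homogeneity at once: going through the layers, the constant is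
    pulled out of each. *)
Lemma le_mixed_normZl p q s alpha (k : \bar R) (g h : R -> R -> R -> \bar R) :
  (0 < p)%R -> (0 < q)%R -> (0 < s)%R -> 0 <= k ->
  measurable_fun setT (fun u : R * R * R => g u.1.1 u.1.2 u.2) ->
  measurable_fun setT (fun u : R * R * R => h u.1.1 u.1.2 u.2) ->
  (forall t z delta, 0 <= g t z delta) ->
  (forall t z delta, g t z delta <= k * h t z delta) ->
  mixed_norm p q s alpha g <= k * mixed_norm p q s alpha h.
Proof.
move=> p0 q0 s0 k0 mg mh g0 gh.
(* A dummy fourth variable plays the part of the parameter in the lemmas above. *)
have mg4 : measurable_fun setT (fun u : R * R * R * R => g u.1.1.1 u.1.1.2 u.1.2).
  exact: (measurableT_comp mg measurable_fst).
have mh4 : measurable_fun setT (fun u : R * R * R * R => h u.1.1.1 u.1.1.2 u.1.2).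
  exact: (measurableT_comp mh measurable_fst).
rewrite !mixed_normE//; apply: le_Lp_onZl => //.
- exact: measurable_T01.
- apply: emeasurable_funM.
    by apply: measurable_funTS; exact: measurable_weight.
  apply: measurable_funTS.
  exact: (@measurable_section_delta _ _ (fun t z delta _ => g t z delta) mg4 p q 0%R).
- apply: emeasurable_funM.
    by apply: measurable_funTS; exact: measurable_weight.
  apply: measurable_funTS.
  exact: (@measurable_section_delta _ _ (fun t z delta _ => h t z delta) mh4 p q 0%R).
- by move=> delta; rewrite mule_ge0 ?Lp_on_ge0// lee_fin powR_ge0.
move=> delta; rewrite muleCA lee_wpmul2l ?lee_fin ?powR_ge0//.
apply: le_Lp_onZl => //.
- apply: measurable_funTS.
  exact: (@measurable_section_z _ _ (fun t z delta _ => g t z delta) mg4 p delta 0%R).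
- apply: measurable_funTS.
  exact: (@measurable_section_z _ _ (fun t z delta _ => h t z delta) mh4 p delta 0%R).
- by move=> z; exact: Lp_on_ge0.
move=> z; apply: le_Lp_onZl => //; first exact: measurable_T01.
- apply: measurable_funTS.
  exact: (@measurable_section_t _ _ (fun t z delta _ => g t z delta) mg4 z delta 0%R).
- apply: measurable_funTS.
  exact: (@measurable_section_t _ _ (fun t z delta _ => h t z delta) mh4 z delta 0%R).
Qed.

(** [Lnorm_Lp_on_le] for the layers in [delta], [z] and [t] in turn, each allowed
    because [m] exceeds its exponent. *)
Lemma Lnorm_mixed_norm_le d (Omega : measurableType d) (P : probability Omega R)
    p q s alpha m (F : R -> R -> R -> Omega -> \bar R) :
  (0 < p < m)%R -> (0 < q < m)%R -> (0 < s < m)%R ->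
  measurable_fun setT (fun u : R * R * R * Omega => F u.1.1.1 u.1.1.2 u.1.2 u.2) ->
  'N[P]_(m%:E)[(fun w => mixed_norm p q s alpha (fun t z delta => F t z delta w))] <=
  mixed_norm p q s alpha (fun t z delta => 'N[P]_(m%:E)[F t z delta]).
Proof.
move=> /andP[p0 pm] /andP[q0 qm] /andP[s0 sm] mF.
have m0 : (0 < m)%R by exact: lt_trans pm.
(* Again with a dummy fourth variable, once [w] has been integrated out. *)
have mN : measurable_fun setT
    (fun u : R * R * R * R => 'N[P]_(m%:E)[F u.1.1.1 u.1.1.2 u.1.2]).
  apply: (@measurable_Lnorm_param _ _ (R * R * R * R)%type _ _ P m
    (fun u => F u.1.1.1 u.1.1.2 u.1.2)).
  apply: (@measurable_fun_comp4 _ _ _ mF _ ((R * R * R * R) * Omega)%type) => //;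
  do ?[exact: measurable_fst | exact: measurable_snd | apply: measurableT_comp => //].
have inner_le delta :
    'N[P]_(m%:E)[(fun w => inner_norm p q (fun t z delta => F t z delta w) delta)] <=
    inner_norm p q (fun t z delta => 'N[P]_(m%:E)[F t z delta]) delta.
  apply: (@le_trans _ _ (Lp_on `[(-1)%R, 1%R] q (fun z =>
      'N[P]_(m%:E)[(fun w => Lp_on (@T01 R) p (fun t => F t z delta w))]))).
    apply: (@Lnorm_Lp_on_le R _ _ P q m _
      (fun z w => Lp_on (@T01 R) p (fun t => F t z delta w))) => //.
    have h : measurable_fun setT (fun u : R * Omega => ((u.1, delta), u.2)).
      by apply: measurable_fun_pair => //; apply: measurable_fun_pair.
    exact: (measurableT_comp (measurable_Lp_on_t mF p) h).
  apply: le_Lp_on => //; first exact: ltW.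
  - apply: measurable_funTS.
    apply: (@measurable_Lnorm_param _ _ R _ _ P m
      (fun z w => Lp_on (@T01 R) p (fun t => F t z delta w))).
    have h : measurable_fun setT (fun u : R * Omega => ((u.1, delta), u.2)).
      by apply: measurable_fun_pair => //; apply: measurable_fun_pair.
    exact: (measurableT_comp (measurable_Lp_on_t mF p) h).
  - apply: measurable_funTS.
    exact: (@measurable_section_z _ _
      (fun t z delta _ => 'N[P]_(m%:E)[F t z delta]) mN p delta 0%R).
  - by move=> z _; exact: Lnorm_ge0.
  move=> z _; apply: (@Lnorm_Lp_on_le R _ _ P p m _ (fun t w => F t z delta w)) => //.
    exact: measurable_T01.
  exact: (measurable_fun_comp4 mF).
rewrite mixed_normE//.
set wt := fun delta : R => (delta `^ ((s / q - alpha * s - 1) / s))%:E.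
have wt0 delta : 0 <= wt delta by rewrite lee_fin powR_ge0.
have mwt : measurable_fun setT wt by exact: measurable_weight.
pose G delta w := wt delta * inner_norm p q (fun t z delta => F t z delta w) delta.
have mG : measurable_fun setT (fun u : R * Omega => G u.1 u.2).
  apply: emeasurable_funM; last exact: measurable_inner_norm.
  exact: (measurableT_comp mwt measurable_fst).
under eq_Lnorm do rewrite mixed_normE//.
apply: (@le_trans _ _ (Lp_on (@T01 R) s (fun delta => 'N[P]_(m%:E)[G delta]))).
  by apply: Lnorm_Lp_on_le => //; exact: measurable_T01.
apply: le_Lp_on; first exact: ltW.
- exact: measurable_T01.
- exact/measurable_funTS/measurable_Lnorm_param.
- apply: measurable_funTS; apply: emeasurable_funM => //.
  exact: (@measurable_section_delta _ _ (fun t z delta _ => 'N[P]_(m%:E)[F t z delta]) mN p q 0%R).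
- by move=> *; exact: Lnorm_ge0.
move=> delta _; rewrite /G LnormZl_ge0//; first by rewrite lee_wpmul2l.
have h : measurable_fun setT (fun w : Omega => (delta, w)) by exact: measurable_fun_pair.
exact: (measurableT_comp (measurable_inner_norm mF p q) h).
Qed.

End Mixed.

(** * Scaling the Besov norm to a mixed norm *)

Section Besov.
Context {R : realType}.
Local Open Scope ereal_scope.

(** The substitution [h = z * delta] contributes the factor [delta] to the integral
    in [h], hence [delta^(1/q)] to its [q]-th root. *)
Lemma Delta_scale (p q delta : R) (f : R -> R) :
  (0 < q)%R -> (0 < delta)%R -> measurable_fun setT (ext0 f) ->
  Delta p q f delta = (delta `^ q^-1)%:E *
    inner_norm p q (fun t z delta => (shift_diff f (z * delta) t)%:E) delta.
Proof.
move=> q0 d0 mf; rewrite /Delta /inner_norm /Lp_on.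
pose phi h := Lp_on (@T01 R) p (fun t => (shift_diff f h t)%:E).
have mphi : measurable_fun setT phi.
  apply: (@measurable_Lp_on_param _ _ R _ p (fun t h => (shift_diff f h t)%:E)).
    exact: measurable_T01.
  apply/measurable_EFinP; apply: measurable_funB.
    apply: (measurableT_comp mf).
    exact: measurable_funD.
  exact: (measurableT_comp mf measurable_fst).
rewrite (@integral_scale R delta (fun h => `|phi h| `^ q) d0); last 2 first.
- exact: measurable_abs_poweR.
- by move=> h; exact: poweR_ge0.
rewrite poweRM ?lee_fin ?(ltW d0)//.
by apply: integral_ge0 => *; exact: poweR_ge0.
Qed.

(** For [delta > 0] the powers of [delta] add up to
    [- alpha * s + s / q - 1], the exponent of the weight [nu]. *)
Lemma Besov_norm_mixed (p q s alpha : R) (f : R -> R) :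
  (0 < p)%R -> (0 < q)%R -> (0 < s)%R -> measurable_fun setT (ext0 f) ->
  Besov_norm p q s alpha f =
  mixed_norm p q s alpha (fun t z delta => (ext0 f (t + z * delta) - ext0 f t)%:E).
Proof.
move=> p0 q0 s0 mf; congr (_ `^ _); apply: eq_integral => delta.
rewrite inE /T01/= in_itv/= => /andP[+ _]; rewrite le_eqVlt => /predU1P[<-|d0].
  (* At [delta = 0] the left-hand side vanishes through [0^-1 = 0], the right-hand
     side because every increment does, whatever the value of [0 `^ _]. *)
  rewrite invr0 mule0; apply/esym.
  have -> : (fun z : R => Lp_on (@T01 R) p
      (fun t : R => (ext0 f (t + z * 0) - ext0 f t)%:E)) = fun=> 0.
    apply/funext => z; rewrite -[RHS](@Lp_on0 R (@T01 R) p p0).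
    by congr Lp_on; apply/funext => t; rewrite mulr0 addr0 subrr.
  by rewrite Lp_on0// poweR0r ?gt_eqF// mule0.
rewrite Delta_scale// -/(inner_norm p q (fun t z delta => (shift_diff f (z * delta) t)%:E) delta).
have B0 : 0 <= inner_norm p q (fun t z delta => (shift_diff f (z * delta) t)%:E) delta.
  exact: Lp_on_ge0.
rewrite muleA -EFinM poweRM ?lee_fin ?mulr_ge0 ?powR_ge0// poweR_EFin.
rewrite muleAC -EFinM; congr (_%:E * _).
rewrite -powRD ?(gt_eqF d0) ?implybT// -powRrM -[X in (_ * X)%R]powR_inv1 ?(ltW d0)//.
rewrite -powRD ?(gt_eqF d0) ?implybT//; congr (_ `^ _)%R.
by ring.
Qed.

End Besov.

(** * The Rosenthal constant and normalized sums *)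

Section Rosenthal.
Context d (Omega : measurableType d) (R : realType) (P : probability Omega R).
Local Open Scope ereal_scope.
Implicit Types (X Y : Omega -> R) (m : R).

Lemma iid_comp (E : Type) (S : set (set E)) (T : Type) (S' : set (set T)) (phi : E -> T)
    (Z : nat -> Omega -> E) :
  (forall B, S' B -> S (phi @^-1` B)) -> iid P S Z ->
  iid P S' (fun k w => phi (Z k w)).
Proof.
move=> mphi [ind same]; split => [J A SA|k A SA].
  exact: (ind J (fun k => phi @^-1` A k) (fun k kJ => mphi _ (SA k kJ))).
exact: same (mphi _ SA).
Qed.

(** Integrability and expectation depend on the law alone: both are integrals with
    respect to the image measure. *)
Lemma centered_eq_law X Y : measurable_fun setT X -> measurable_fun setT Y ->
  (forall B : set R, measurable B -> P (X @^-1` B) = P (Y @^-1` B)) ->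
  centered P X -> centered P Y.
Proof.
move=> mX mY XY [/integrableP[_ iX] EX].
have abs_eq : \int[P]_w `|(X w)%:E| = \int[P]_w `|(Y w)%:E|.
  have mabs : measurable_fun setT (fun x : R => `|x%:E|).
    exact: measurableT_comp.
  rewrite -(ge0_integral_pushforward mX P measurableT mabs)//.
  rewrite -(ge0_integral_pushforward mY P measurableT mabs)//.
  by apply: eq_measure_integral => A mA _; exact: XY.
have iY : P.-integrable setT (EFin \o Y).
  by apply/integrableP; split; [exact/measurable_EFinP|rewrite -abs_eq].
have iX' : P.-integrable setT (EFin \o X).
  by apply/integrableP; split; [exact/measurable_EFinP|].
split => //; move: EX; rewrite unlock => <-; symmetry.
have mE : measurable_fun [set: R] (@EFin R) by exact: EFin_measurable.
rewrite -(@integral_pushforward _ _ _ _ _ X mX P setT EFin mE iX' measurableT).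
rewrite -(@integral_pushforward _ _ _ _ _ Y mY P setT EFin mE iY measurableT).
by apply: eq_measure_integral => A mA _; exact: XY.
Qed.

Lemma Lnorm_eq0_ae m X : (0 < m)%R -> measurable_fun setT X ->
  'N[P]_(m%:E)[EFin \o X] = 0 <-> (\forall w \ae P, X w = 0%R).
Proof.
move=> m0 mX; split.
  move=> /(Lnorm_eq0_eq0 (iffRL (measurable_EFinP _ _) mX)).
  move=> /(_ m0); apply: filterS => w /(_ I) /= h; by case: h.
move=> h; rewrite LnormEpow.
rewrite (@ge0_ae_eq_integral _ _ _ P setT _ (cst 0)) ?integral0 ?poweR0r ?invr_neq0 ?gt_eqF//.
- by apply: measurable_abs_poweR; exact/measurable_EFinP.
- by move=> *; exact: poweR_ge0.
- by apply: filterS h => w Xw _; rewrite /= Xw normr0 powR0 ?gt_eqF.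
Qed.

(** The sequence [X] is admissible in the supremum that defines [K_R]. *)
Lemma ratio_le_K_R m n (X : nat -> Omega -> R) : (1 <= n)%N ->
  (forall k, measurable_fun setT (X k)) ->
  iid P (@measurable _ R) X -> (forall k, centered P (X k)) ->
  0 < 'N[P]_(m%:E)[EFin \o X 0%N] < +oo ->
  'N[P]_(m%:E)[EFin \o normalized_sum n X] / 'N[P]_(m%:E)[EFin \o X 0%N] <= K_R m.
Proof.
move=> n1 mX iX cX N0.
pose zeta k : {RV P >-> R} :=
  HB.pack (X k) (isMeasurableFun.Build _ _ _ _ (X k) (mX k)).
apply: (@le_trans _ _ (ereal_sup (Rosenthal_ratios m n))).
  by apply: ereal_sup_ubound; exists d, Omega, P, zeta.
by apply: ereal_sup_ubound; exists n.
Qed.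

(** A variable of constant sign has [E|X| = |E X| = 0]. *)
Lemma centered_sign_const X : measurable_fun setT X -> centered P X ->
  (\forall w \ae P, (0 < X w)%R) \/ (\forall w \ae P, (X w <= 0)%R) ->
  \forall w \ae P, X w = 0%R.
Proof.
move=> mX [iX]; rewrite unlock => EX sgn.
have mEX : measurable_fun setT (EFin \o X) by exact/measurable_EFinP.
have : \int[P]_w `|(EFin \o X) w| = 0.
  case: sgn => h.
    rewrite -[RHS]EX; apply: ae_eq_integral => //; first exact: measurableT_comp.
    by apply: filterS h => w X0 _ /=; rewrite gtr0_norm.
  rewrite -[RHS]oppe0 -EX -integralN; last exact: integrable_add_def.
  apply: ae_eq_integral => //; do ?exact: measurableT_comp.
  by apply: filterS h => w X0 _ /=; rewrite ler0_norm.
move=> /(ae_eq_integral_abs P measurableT mEX).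
by apply: filterS => w /(_ I) /= h; case: h.
Qed.

(** The ratio in the definition of [K_R] equals [1] for [n = 1], but [X] itself may
    have infinite norm and hence be excluded from the supremum.  The centered
    indicators of [0 < X k] are bounded; their norm does not vanish, since
    otherwise the sign of [X 0] would be constant and [X 0], being centered, zero. *)
Lemma K_R_gt0 m (X : nat -> Omega -> R) : (0 < m)%R ->
  (forall k, measurable_fun setT (X k)) ->
  iid P (@measurable _ R) X -> centered P (X 0%N) ->
  'N[P]_(m%:E)[EFin \o X 0%N] != 0 -> 0 < K_R m.
Proof.
move=> m0 mX iX cX NX.
pose c := fine (P (X 0%N @^-1` `]0%R, +oo[)).
pose phi (x : R) : R := (\1_(`]0%R, +oo[%classic) x - c)%R.
have mphi : measurable_fun setT phi.
  by apply: measurable_funB => //; exact: measurable_indic.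
pose zeta k w := phi (X k w).
have mzeta k : measurable_fun setT (zeta k) by exact: (measurableT_comp mphi (mX k)).
have izeta : iid P (@measurable _ R) zeta.
  apply: (@iid_comp R measurable R measurable phi X _ iX) => B mB.
  by rewrite -(setTI (_ @^-1` _)); exact: mphi.
have mA : measurable (X 0%N @^-1` `]0%R, +oo[).
  by rewrite -(setTI (_ @^-1` _)); exact: mX.
have c0 : centered P (zeta 0%N).
  have e : EFin \o zeta 0%N = (fun w => (\1_(X 0%N @^-1` `]0%R, +oo[) w)%:E - (EFin \o cst c) w).
    by apply/funext.
  have i1 : P.-integrable setT (fun w => (\1_(X 0%N @^-1` `]0%R, +oo[) w)%:E).
    exact: integrable_indic.
  have i2 : P.-integrable setT (EFin \o cst c).
    exact: finite_measure_integrable_cst.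
  split; first by rewrite e; exact: integrableB.
  rewrite unlock -/(EFin \o zeta 0%N) e integralB//.
  rewrite integral_indic// setIT.
  rewrite -[X in _ - X]/(\int[P]_w (cst c%:E) w) integral_cst// [X in _ * X]probability_setT mule1.
  by rewrite fineK ?fin_num_measure// subee// fin_num_measure.
have cz k : centered P (zeta k).
  apply: (centered_eq_law (mzeta 0%N) (mzeta k) _ c0) => B mB.
  by case: izeta => _ /(_ k B mB).
have N0 : 'N[P]_(m%:E)[EFin \o zeta 0%N] != 0.
  apply: contra NX => /eqP /(Lnorm_eq0_ae m0 (mzeta 0%N)) h.
  apply/eqP/(Lnorm_eq0_ae m0 (mX 0%N))/centered_sign_const => //.
  have [c1|c1] := eqVneq c 1%R; [left|right]; apply: filterS h => w.
    rewrite /zeta /phi c1 indicE; case: (boolP (_ \in _)) => /=.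
      by rewrite inE/= in_itv/= andbT.
    by move=> _ /eqP; rewrite sub0r oppr_eq0 oner_eq0.
  rewrite /zeta /phi indicE; case: (boolP (_ \in _)) => /=.
    by move=> _ /eqP; rewrite subr_eq0 eq_sym (negbTE c1).
  by rewrite notin_setE /= in_itv/= andbT => /negP; rewrite -leNgt.
have c01 : (0 <= c <= 1)%R.
  by rewrite fine_ge0//= -lee_fin fineK ?fin_num_measure//; exact: probability_le1.
have Noo : 'N[P]_(m%:E)[EFin \o zeta 0%N] < +oo.
  rewrite LnormEpow; apply: poweR_lty.
  apply: (@le_lt_trans _ _ (\int[P]_w (cst 1) w)).
    apply: ge0_le_integral => //.
    - by move=> *; exact: poweR_ge0.
    - by apply: measurable_abs_poweR; exact/measurable_EFinP.
    move=> w _; rewrite -[leRHS](poweR1r m); apply: lee_poweR => //; first exact: ltW.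
    rewrite /= lee_fin /zeta /phi indicE ler_norml.
    by case/andP: c01 => c0' c1'; case: (_ \in _) => /=; apply/andP; split; lra.
  by rewrite integral_cst// [X in _ * X]probability_setT mule1 ltry.
have : 'N[P]_(m%:E)[EFin \o normalized_sum 1 zeta] / 'N[P]_(m%:E)[EFin \o zeta 0%N] <= K_R m.
  by apply: ratio_le_K_R => //; rewrite lt0e N0 Lnorm_ge0 Noo.
have -> : normalized_sum 1 zeta = zeta 0%N.
  by apply/funext => w; rewrite /normalized_sum big_ord1 sqrtr1 invr1 mul1r.
apply: lt_le_trans.
by rewrite divee ?lte01// ge0_fin_numE// Lnorm_ge0.
Qed.

(** When the norm of [X 0] is positive and finite this is the definition of [K_R].
    The cases [0] and [+oo] are those described at the top; there the
    conventions [+oo * 0 = 0] and [x * +oo = +oo] for [x > 0] matter. *)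
Lemma Lnorm_normalized_sum_le m n (X : nat -> Omega -> R) : (0 < m)%R -> (1 <= n)%N ->
  (forall k, measurable_fun setT (X k)) ->
  iid P (@measurable _ R) X -> centered P (X 0%N) ->
  'N[P]_(m%:E)[EFin \o normalized_sum n X] <= K_R m * 'N[P]_(m%:E)[EFin \o X 0%N].
Proof.
move=> m0 n1 mX iX cX.
have [N0|N0] := eqVneq ('N[P]_(m%:E)[EFin \o X 0%N]) 0.
  rewrite N0 mule0.
  have h : forall k, \forall w \ae P, X k w = 0%R.
    move=> k; have mB : measurable (~` [set 0%R] : set R) by exact: measurableC.
    case: iX => _ /(_ k _ mB) same.
    have mk j : measurable (X j @^-1` ~` [set 0%R]).
      by rewrite -(setTI (_ @^-1` _)); exact: mX.
    move/(Lnorm_eq0_ae m0 (mX 0%N)) : N0 => /(negligibleP P (mk 0%N)) h0.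
    apply/(negligibleP P (mk k)); exact: (etrans same h0).
  suff -> : 'N[P]_(m%:E)[EFin \o normalized_sum n X] = 0 by [].
  apply/Lnorm_eq0_ae => //.
    by apply: measurable_funM => //; exact: measurable_sum.
  apply: filterS (ae_foralln h) => w hw.
  by rewrite /normalized_sum big1 ?mulr0.
have K0 := K_R_gt0 m0 mX iX cX N0.
have cXk k : centered P (X k).
  apply: (centered_eq_law (mX 0%N) (mX k) _ cX) => B mB.
  by case: iX => _ /(_ k B mB).
have [Noo|Noo] := eqVneq ('N[P]_(m%:E)[EFin \o X 0%N]) +oo.
  by rewrite Noo gt0_muley// leey.
have Nfin : 'N[P]_(m%:E)[EFin \o X 0%N] \is a fin_num.
  by rewrite ge0_fin_numE ?Lnorm_ge0// ltey.
have Npos : 0 < 'N[P]_(m%:E)[EFin \o X 0%N] by rewrite lt0e N0 Lnorm_ge0.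
have : 'N[P]_(m%:E)[EFin \o normalized_sum n X] / 'N[P]_(m%:E)[EFin \o X 0%N] <= K_R m.
  by apply: ratio_le_K_R => //; rewrite Npos ltey.
case: ('N[P]_(m%:E)[EFin \o X 0%N]) Nfin Npos => [c| |]//= _; rewrite lte_fin => c0.
by rewrite inver gt_eqF// lee_pdivrMr.
Qed.

End Rosenthal.

(** * Grand Lebesgue norms and exponential tails *)

Section GrandLebesgue.
Context d (Omega : measurableType d) (R : realType) (P : probability Omega R).
Local Open Scope ereal_scope.

(** Where [kap m = 0], the bound forces the norm to vanish and the quotient [0 / 0]
    is [0]. *)
Lemma GL_norm_le1 (m0 : R) (L : \bar R) (kap : R -> \bar R) (Y : Omega -> \bar R) :
  (forall m, exponents m0 L m -> 'N[P]_(m%:E)[Y] <= kap m < +oo) ->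
  GL_norm m0 L kap P Y <= 1.
Proof.
move=> H; apply: ge_ereal_sup => _ [m /H /andP[+ +] <-].
have := Lnorm_ge0 P m%:E Y.
case: (kap m) => [c| |] // N0; last by move=> /(le_trans N0).
have [c0|c0 + _|-> + _] := ltgtP c 0%R.
- by move=> /(le_trans N0); rewrite lee_fin leNgt c0.
- by move=> Nc; rewrite inver gt_eqF// lee_pdivrMr// mul1e.
- by move=> Nle; have -> : 'N[P]_(m%:E)[Y] = 0; [apply/eqP; rewrite eq_le Nle|rewrite mul0e].
Qed.

(** Markov's inequality for the [m]-th power. *)
Lemma tail_le_pow (m u : R) (c : R) (Y : Omega -> \bar R) : (0 < m)%R -> (0 < u)%R ->
  (0 <= c)%R -> measurable_fun setT Y -> (forall w, 0 <= Y w) -> 'N[P]_(m%:E)[Y] <= c%:E ->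
  P [set w | u%:E < Y w] <= ((c / u) `^ m)%:E.
Proof.
move=> m0 u0 c0 mY Y0 NY.
have um0 : (0 < u `^ m)%R by exact: powR_gt0.
have mYm : measurable_fun setT (fun w => Y w `^ m) by exact: measurable_fun_poweR.
have := le_integral_abse P measurableT mYm um0.
under eq_integral do rewrite gee0_abs ?poweR_ge0//.
have -> : \int[P]_w Y w `^ m = 'N[P]_(m%:E)[Y] `^ m.
  rewrite LnormEpow poweRVK ?gt_eqF//; last first.
    by apply: integral_ge0 => *; exact: poweR_ge0.
  by apply: eq_integral => w _; rewrite gee0_abs.
move=> h.
have {}h := le_trans h (lee_poweR (ltW m0) (Lnorm_ge0 P m%:E Y) NY).
rewrite -lee_pdivlMl// in h.
have -> : ((c / u) `^ m)%:E = (u `^ m)^-1%:E * c%:E `^ m.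
  rewrite poweR_EFin -EFinM; congr EFin.
  apply: (mulfI (lt0r_neq0 um0)); rewrite mulrA mulfV ?gt_eqF// mul1r.
  by rewrite -powRM ?divr_ge0 ?(ltW u0)// mulrC divfK ?gt_eqF.
apply: le_trans h; apply: le_measure; rewrite ?inE.
- by rewrite -[X in measurable X]setTI; exact: emeasurable_fun_o_infty.
- by apply: emeasurable_fun_c_infty => //; exact: measurableT_comp.
- move=> w /= uY; split => //; rewrite gee0_abs ?poweR_ge0// -poweR_EFin.
  by apply: lee_poweR; [exact: ltW|rewrite lee_fin ltW|exact: ltW].
Qed.

(** For each [m] the bound [(kap m / u)^m] of [tail_le_pow] is the exponential of
    [- (m * ln u - m * ln (kap m))]; after taking logarithms, the infimum over
    [m] becomes minus the supremum that defines [kappa_tilde_star]. *)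
Lemma tail_le_expeR (m0 : R) (L : \bar R) (kap : R -> \bar R) (Y : Omega -> \bar R) (u : R) :
  (0 <= m0)%R -> measurable_fun setT Y -> (forall w, 0 <= Y w) ->
  (forall m, exponents m0 L m -> 'N[P]_(m%:E)[Y] <= kap m < +oo) -> (1 < u)%R ->
  tail P Y u <= expeR (- kappa_tilde_star m0 L kap (ln u)).
Proof.
move=> m00 mY Y0 H u1; have u0 : (0 < u)%R by exact: lt_trans u1.
rewrite /tail; have -> : [set w | Y w < (- u)%:E] = set0.
  apply/seteqP; split => // w /= h; have := le_lt_trans (Y0 w) h.
  by rewrite lte_fin oppr_gt0 ltNge (ltW u0).
rewrite measure0 ge_max expeR_ge0 andbT.
set p := P _; have p0 : 0 <= p by exact: measure_ge0.
rewrite -[p](eqP (_ : expeR (lne p) == p)) ?lneK_eq// lee_expeR leeNr.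
apply: ge_ereal_sup => _ [m mm <-].
rewrite leeNr -lee_expeR (eqP (_ : expeR (lne p) == p)) ?lneK_eq//.
have m_gt0 : (0 < m)%R by case: mm => + _; exact: le_lt_trans.
have /andP[Nk koo] := H m mm.
have k0 := le_trans (Lnorm_ge0 P m%:E Y) Nk.
rewrite /kappa_tilde; move: Nk koo k0.
case: (kap m) => [c| |]// Nk _; rewrite lee_fin => c0.
have hp := tail_le_pow m_gt0 u0 c0 mY Y0 Nk.
apply: (le_trans hp).
move: c0; rewrite le_eqVlt => /predU1P[<-|c0].
  by rewrite mul0r powR0 ?gt_eqF// expeR_ge0.
rewrite lne_EFin// ger0_norm ?ln_ge0 ?(ltW u1)// -EFinM -EFinB -EFinN /= lee_fin.
by rewrite /powR gt_eqF ?divr_gt0// ln_div// opprB mulrBr.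
Qed.

End GrandLebesgue.

(** * Increments of the process *)

Section Process.
Context {R : realType}.

(** Evaluations at points of [[0, 1]] are measurable for [path_sigma] by definition,
    and evaluations of the extension outside [[0, 1]] are constant. *)
Lemma path_sigma_increment (t t' : R) (B : set R) : measurable B ->
  @path_sigma R ((fun f => ext0 f t' - ext0 f t) @^-1` B).
Proof.
pose G := [set A | exists t : R, exists B : set R,
         [/\ T01 t, measurable B & A = [set f : R -> R | B (f t)]]].
pose S := g_sigma_algebraType G.
have mev t0 : measurable_fun (setT : set S) (fun f : S => ext0 f t0).
  rewrite /ext0; have [t0T|t0T] := boolP (t0 \in `[0, 1]); last exact: measurable_cst.
  move=> _ C mC; rewrite setTI; apply: sub_sigma_algebra.
  by exists t0, C; split => //.
move=> mB; rewrite -[X in path_sigma X]setTI.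
have : measurable_fun (setT : set S) (fun f : S => ext0 f t' - ext0 f t).
  exact: measurable_funB.
by move=> /(_ measurableT B mB).
Qed.

Lemma measurable_ext0 d (Omega : measurableType d) (xi : R -> Omega -> R) :
  bimeasurable xi ->
  measurable_fun setT (fun u : R * Omega => ext0 (xi ^~ u.2) u.1).
Proof.
move=> mxi; have -> : (fun u : R * Omega => ext0 (xi ^~ u.2) u.1) =
    (fun u => xi u.1 u.2) \_ (@T01 R `*` setT).
  apply/funext => -[t w]; rewrite /ext0 /patch/=; congr (if _ then _ else _).
  by apply/idP/idP; rewrite !inE => // -[].
apply/(measurable_restrictT _ _).1 => //.
by apply: measurableX => //; exact: measurable_T01.
Qed.

Lemma ext0_Sn d (Omega : measurableType d) (xis : nat -> R -> Omega -> R) n w t :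
  ext0 (Sn xis n w) t = normalized_sum n (fun k w => ext0 (xis k ^~ w) t) w.
Proof.
rewrite /ext0; case: ifPn => // _.
by rewrite /normalized_sum big1 ?mulr0.
Qed.

Lemma measurable_normalized_sum dT (T : measurableType dT) n (X : nat -> T -> R) :
  (forall k, measurable_fun setT (X k)) -> measurable_fun setT (normalized_sum n X).
Proof. by move=> mX; apply: measurable_funM => //; exact: measurable_sum. Qed.

Lemma centered_ext0_increment d (Omega : measurableType d) (P : probability Omega R)
    (xi : R -> Omega -> R) t t' :
  (forall t, T01 t -> centered P (xi t)) ->
  centered P (fun w => ext0 (xi ^~ w) t' - ext0 (xi ^~ w) t).
Proof.
move=> cxi; have c0 u : centered P (fun w => ext0 (xi ^~ w) u).
  rewrite /ext0; have [uT|uT] := boolP (u \in `[0, 1]); first exact: cxi.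
  split; first exact: (finite_measure_integrable_cst P 0 measurableT).
  exact: expectation_cst.
have [i1 e1] := c0 t'; have [i2 e2] := c0 t.
split; first exact: (integrableB measurableT i1 i2).
move: e1 e2; rewrite !unlock => e1 e2.
transitivity (\int[P]_w ((ext0 (xi ^~ w) t')%:E - (ext0 (xi ^~ w) t)%:E))%E.
  by [].
by rewrite integralB_EFin// e1 e2 sube0.
Qed.

End Process.

Section Main.
Context (R : realType) (d : measure_display) (Omega : measurableType d)
  (P : probability Omega R) (xis : nat -> R -> Omega -> R).
Hypothesis mxi : forall k, bimeasurable (xis k).
Hypothesis cxi : forall t, T01 t -> centered P (xis 0%N t).
Hypothesis ixi : iid P (@path_sigma R) (fun k w t => xis k t w).
Local Open Scope ereal_scope.

Lemma measurable_scaled_increment (X : R -> Omega -> R) :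
  measurable_fun setT (fun u : R * Omega => X u.1 u.2) ->
  measurable_fun setT (fun u : R * R * R * Omega =>
    (X (u.1.1.1 + u.1.1.2 * u.1.2) u.2 - X u.1.1.1 u.2)%R%:E).
Proof.
move=> mX; apply/measurable_EFinP; apply: measurable_funB.
  apply: (measurable_fun_comp2 mX) => //.
  apply: measurable_funD; last apply: measurable_funM.
  all: do ?[exact: measurable_fst | exact: measurable_snd | apply: measurableT_comp => //].
apply: (measurable_fun_comp2 mX) => //.
all: do ?[exact: measurable_fst | exact: measurable_snd | apply: measurableT_comp => //].
Qed.

(** The law of an increment is the image of the law of the path. *)
Lemma iid_increment t t' :
  iid P (@measurable _ R) (fun k w => ext0 (xis k ^~ w) t' - ext0 (xis k ^~ w) t)%R.
Proof.
exact: (@iid_comp _ _ _ P _ _ _ _ (fun f => ext0 f t' - ext0 f t)%R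
  (fun k w u => xis k u w) (@path_sigma_increment R t t')).
Qed.

Lemma measurable_increment k t t' :
  measurable_fun setT (fun w => ext0 (xis k ^~ w) t' - ext0 (xis k ^~ w) t)%R.
Proof.
have mu u : measurable_fun setT (fun w => ext0 (xis k ^~ w) u).
  exact: (@measurable_fun_comp2 _ _ _ _ R Omega Omega R (fun t w => ext0 (xis k ^~ w) t)
    (cst u) id (measurable_ext0 (mxi k))).
exact: measurable_funB.
Qed.

Lemma K_R_gt0_increment (m : R) (t t' : R) : (0 < m)%R ->
  dist P (xis 0%N) m t' t != 0 -> 0 < K_R m :> \bar R.
Proof.
move=> m0 dtt'; apply: (K_R_gt0 m0 _ (iid_increment t t') _ dtt').
- by move=> k; exact: measurable_increment.
- exact: centered_ext0_increment.
Qed.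

Lemma Lnorm_Sn_increment_le (m : R) n (t t' : R) : (0 < m)%R -> (1 <= n)%N ->
  'N[P]_(m%:E)[(fun w => (ext0 (Sn xis n w) t' - ext0 (Sn xis n w) t)%R%:E)] <=
  K_R m * dist P (xis 0%N) m t' t.
Proof.
move=> m0 n1.
pose X k w := (ext0 (xis k ^~ w) t' - ext0 (xis k ^~ w) t)%R.
have -> : (fun w => (ext0 (Sn xis n w) t' - ext0 (Sn xis n w) t)%R%:E) =
    EFin \o normalized_sum n X.
  apply/funext => w /=; congr EFin.
  by rewrite !ext0_Sn /normalized_sum -mulrBr -sumrB.
apply: (@Lnorm_normalized_sum_le _ _ _ P m n X) => //.
- by move=> k; exact: measurable_increment.
- exact: iid_increment.
- exact: centered_ext0_increment.
Qed.

End Main.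

(** * The bound for the Besov norm of normalized sums *)

Theorem proposition7p1 (R : realType) (d : measure_display)
    (Omega : measurableType d) (P : probability Omega R)
    (p q s alpha : R) (L' : \bar R)
    (xi : R -> Omega -> R) (xis : nat -> R -> Omega -> R) :
  let m0 : R := Num.max 2 (Num.max p (Num.max q s)) in
  1 <= p -> 1 <= q -> 1 <= s ->
  bimeasurable xi ->
  (forall t, T01 t -> centered P (xi t)) ->
  xis 0%N = xi ->
  (forall k, bimeasurable (xis k)) ->
  iid P (@path_sigma R) (fun k w t => xis k t w) ->
  (m0%:E < L')%E ->
  (forall m, exponents m0 L' m -> (kappa P p q s alpha xi m < +oo)%E) ->
  forall n : nat, (1 <= n)%N ->
  let tau := fun w => Besov_norm p q s alpha (Sn xis n w) in
  [/\ in_GL m0 L' (kappa P p q s alpha xi) P tau,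
      (GL_norm m0 L' (kappa P p q s alpha xi) P tau <= 1)%E &
      forall u : R, expR 1 < u ->
        (tail P tau u <=
         expeR (- kappa_tilde_star m0 L' (kappa P p q s alpha xi) (ln u)))%E].
Proof.
move=> m0 p1 q1 s1 _ cxi xi0 mxi ixi _ koo n n1 tau.
subst xi.
have p0 : 0 < p by exact: lt_le_trans p1.
have q0 : 0 < q by exact: lt_le_trans q1.
have s0 : 0 < s by exact: lt_le_trans s1.
have mS : measurable_fun setT (fun u : R * Omega => ext0 (Sn xis n u.2) u.1).
  under eq_fun do rewrite ext0_Sn.
  exact: (@measurable_normalized_sum R _ _ n (fun k u => ext0 (xis k ^~ u.2) u.1)
    (fun k => measurable_ext0 (mxi k))).
pose F t z delta w : \bar R :=
  (ext0 (Sn xis n w) (t + z * delta) - ext0 (Sn xis n w) t)%:E.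
have mF : measurable_fun setT (fun u : R * R * R * Omega => F u.1.1.1 u.1.1.2 u.1.2 u.2).
  exact: (@measurable_scaled_increment R _ Omega (fun t w => ext0 (Sn xis n w) t)).
have tauE : tau = fun w => mixed_norm p q s alpha (fun t z delta => F t z delta w).
  apply/funext => w; apply: Besov_norm_mixed => //.
  exact: (@measurable_fun_comp2 _ _ _ _ R Omega R R (fun t w => ext0 (Sn xis n w) t)
    id (cst w) mS).
have mtau : measurable_fun setT tau by rewrite tauE; exact: measurable_mixed_norm.
have tau0 w : (0 <= tau w)%E by exact: poweR_ge0.
have m00 : 0 <= m0 by rewrite le_max ler0n.
have H m : exponents m0 L' m ->
    ('N[P]_(m%:E)[tau] <= kappa P p q s alpha (xis 0%N) m < +oo)%E.
  move=> mm; rewrite koo// andbT.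
  have [+ _] := mm; rewrite !gt_max => /and4P[m2 pm qm sm].
  have m_gt0 : 0 < m by exact: lt_trans m2.
  rewrite tauE; apply: le_trans.
    by apply: (@Lnorm_mixed_norm_le R _ _ P p q s alpha m F) mF; rewrite ?p0 ?q0 ?s0.
  have mN : measurable_fun setT (fun u : R * R * R => 'N[P]_(m%:E)[F u.1.1 u.1.2 u.2])%E.
    apply: (@measurable_Lnorm_param _ _ (R * R * R)%type _ _ P m (fun u => F u.1.1 u.1.2 u.2)).
    exact: mF.
  have md : measurable_fun setT
      (fun u : R * R * R => dist P (xis 0%N) m (u.1.1 + u.1.2 * u.2) u.1.1).
    pose G t z delta w : \bar R :=
      (ext0 (xis 0%N ^~ w) (t + z * delta) - ext0 (xis 0%N ^~ w) t)%:E.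
    apply: (@measurable_Lnorm_param _ _ (R * R * R)%type _ _ P m (fun u => G u.1.1 u.1.2 u.2)).
    exact: (@measurable_scaled_increment R _ Omega (fun t w => ext0 (xis 0%N ^~ w) t)
      (measurable_ext0 (mxi 0%N))).
  have N0 t z delta : (0 <= 'N[P]_(m%:E)[F t z delta])%E by exact: Lnorm_ge0.
  have NF t z delta : ('N[P]_(m%:E)[F t z delta] <=
      K_R m * dist P (xis 0%N) m (t + z * delta) t)%E.
    exact: Lnorm_Sn_increment_le.
  have [[t [t' dtt']]|d0] := pselect (exists t t', dist P (xis 0%N) m t' t != 0%E).
    apply: le_mixed_normZl => //; apply: ltW.
    exact: (K_R_gt0_increment mxi cxi ixi m_gt0 dtt').
  have {}d0 t t' : dist P (xis 0%N) m t' t = 0%E.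
    by apply: contrapT => /eqP h; apply: d0; exists t, t'.
  (* If every increment has norm [0], then so has [tau], and [kappa m = 0]. *)
  have M0 : (mixed_norm p q s alpha (fun t z delta => dist P (xis 0%N) m (t + z * delta) t) = 0)%E.
    apply/eqP; rewrite eq_le poweR_ge0 andbT -[leRHS](mul0e (mixed_norm p q s alpha
      (fun t z delta => dist P (xis 0%N) m (t + z * delta) t))).
    by apply: le_mixed_normZl => // t z delta; rewrite d0 ?mul0e.
  rewrite /kappa M0 mule0 -[leRHS](mule0 1%E) -M0; apply: le_mixed_normZl => //.
  by move=> t z delta; apply: (le_trans (NF _ _ _)); rewrite d0 !mule0.
have G1 := GL_norm_le1 H.
split => //; first by split => //; apply: le_lt_trans G1 _; rewrite ltry.
move=> u u1; apply: tail_le_expeR => //.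
by apply: lt_trans u1; rewrite expR_gt1.
Qed.
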